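(* Let $U(\mathbb{Z}^1)\subset\mathbb{Z}^2$ be the Ulam spiral (defined in the context), and let $G$ be the spanning subgraph of the lattice graph $\mathbb{Z}^2$ whose vertex set is $\mathbb{Z}^2$ and whose edges are the edges of $U(\mathbb{Z}^1)$ together with all edges $\{(0,y),(0,y+1)\}$, $y\in\mathbb{Z}$, of the vertical line $x=0$. Then $G$ has dimension $D=2$, that is, the same dimension as $\mathbb{Z}^2$; explicitly, $$\lim_{r\to\infty}\frac{\ln \partial\beta(G,(0,0),r)}{\ln r}+1=2 .$$
   Context: $\mathbb{Z}^2$ denotes the graph with vertex set $\mathbb{Z}^2$ in which two vertices are adjacent iff their $\ell^1$-distance is $1$. A spanning subgraph has the same vertex set and a subset of the edges; it carries its own path metric. For a connected graph $G$ with path metric $d_G$, a vertex $x$ and $r\in\mathbb{N}_0$, set $\beta(G,x,r)=|\{y: d_G(x,y)\le r\}|$ and $\partial\beta(G,x,r)=\beta(G,x,r)-\beta(G,x,r-1)$, the number of vertices at distance exactly $r$ from $x$. The dimension $D$ of $G$ is $\lim_{r\to\infty}\bigl(\ln\partial\beta(G,x,r)/\ln r\bigr)+1$ when this limit exists. Ulam spiral: $U:\mathbb{Z}\to\mathbb{Z}^2$ is the following bijection mapping consecutive integers to lattice neighbours. $U(0)=(0,0)$ and $U(-m)=-U(m)$ for all $m$. For positive integers, starting at $(0,0)$, one walks with unit steps: $1$ step right, $1$ up, $3$ left, $3$ down, $5$ right, $5$ up, $7$ left, $7$ down, $9$ right, $9$ up, and so on (directions cycle right, up, left, down; step counts are $1,1,3,3,5,5,7,7,\dots$),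 and $U(m)$ is the position after $m$ steps. Thus $U(1)=(1,0)$, $U(2)=(1,1)$, $U(3)=(0,1)$, $U(-1)=(-1,0)$, $U(-2)=(-1,-1)$, $U(-3)=(0,-1)$, $U(-10)=(0,2)$, $U(21)=(0,3)$, $U(-36)=(0,4)$. $U(\mathbb{Z}^1)$ is the spanning subgraph of $\mathbb{Z}^2$ with edges $\{U(m),U(m+1)\}$, $m\in\mathbb{Z}$. *)

(* Defs.v *)
From HB Require Import structures.
From mathcomp Require Import all_boot all_order all_algebra finmap.
From mathcomp Require Import all_classical all_reals all_analysis.

Set Implicit Arguments.
Unset Strict Implicit.
Unset Printing Implicit Defensive.

Import Order.TTheory GRing.Theory Num.Theory.
Import numFieldNormedType.Exports.

Local Open Scope classical_set_scope.
Local Open Scope ring_scope.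

Section Graph.
Variables (V : choiceType) (e : rel V).

Definition walk (x y : V) (n : nat) : Prop :=
  exists2 p : seq V, path e x p & last x p = y /\ size p = n.

Definition graph_connected : Prop := forall x y : V, exists n, walk x y n.

(* The path metric of a connected graph; the value 0 for vertices that no
   walk joins is a dummy, and [has_dimension] requires connectedness. *)
Definition gdist (x y : V) : nat :=
  if pselect (exists n, `[< walk x y n >]) is left h then ex_minn h else 0%N.

(* Balls are finite in a locally finite connected graph; [fset_set] sends an
   infinite set to the empty one. *)
Definition beta (x : V) (r : nat) : nat :=
  #|` fset_set [set y | (gdist x y <= r)%N]|%fset.

(* beta(x, r) - beta(x, r - 1), where beta(x, -1) = 0. *)
Definition dbeta (x : V) (r : nat) : nat :=
  if r is r'.+1 then (beta x r - beta x r')%N else beta x 0.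

(* The terms r = 0, 1, where ln r = 0 in [R], do not affect the limit. *)
Definition has_dimension (R : realType) (x : V) (D : R) : Prop :=
  graph_connected /\
  (ln ((dbeta x r)%:R : R) / ln (r%:R : R) + 1) @[r --> \oo] --> D.

End Graph.

Notation Z2 := (int * int)%type.

Definition lattice : rel Z2 :=
  fun p q => `|p.1 - q.1| + `|p.2 - q.2| == 1.

Definition direction (k : nat) : Z2 :=
  match (k %% 4)%N with
  | 0 => (1, 0)
  | 1 => (0, 1)
  | 2 => (-1, 0)
  | _ => (0, -1)
  end.

(* The steps of the first n straight legs of the walk; the legs k = 0, 1, 2, ...
   have 1, 1, 3, 3, 5, 5, ... steps. *)
Definition steps (n : nat) : seq Z2 :=
  flatten [seq nseq (k./2).*2.+1 (direction k) | k <- iota 0 n].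

(* The first m legs comprise at least m steps. *)
Definition ulam_nat (m : nat) : Z2 := \sum_(s <- take m (steps m)) s.

Definition ulam (m : int) : Z2 :=
  match m with
  | Posz n => ulam_nat n
  | Negz n => - ulam_nat n.+1
  end.

Definition spiral : rel Z2 := fun p q =>
  `[< exists m : int, (p = ulam m /\ q = ulam (m + 1)) \/
                      (q = ulam m /\ p = ulam (m + 1)) >].

Definition vertical_line : rel Z2 := fun p q =>
  `[< exists y : int, (p = (0, y) /\ q = (0, y + 1)) \/
                      (q = (0, y) /\ p = (0, y + 1)) >].

Definition spiral_with_line : rel Z2 := fun p q => spiral p q || vertical_line p q.

Lemma size_steps m : (m <= size (steps m))%N.
Proof.
elim: m => // m IH; rewrite /steps -addn1 iotaD map_cat flatten_cat size_cat.
by rewrite leq_add // /= cats0 size_nseq.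
Qed.

Lemma lattice_direction (p : Z2) s : s \in [seq direction k | k <- iota 0 4] ->
  lattice p (p + s) && lattice (p + s) p.
Proof.
have dl (a x : int) : a - (a + x) = - x by rewrite opprD addNKr.
have dr (a x : int) : a + x - a = x by rewrite addrC addKr.
by rewrite /= !inE => /or4P[]/eqP->; rewrite /lattice /= !dl !dr.
Qed.

Lemma mem_steps n s : s \in steps n -> s \in [seq direction k | k <- iota 0 4].
Proof.
case/flattenP => t /mapP[k _ ->] /nseqP[-> _]; apply/mapP; exists (k %% 4)%N.
  by rewrite mem_iota /= ltn_mod.
by rewrite /direction modn_mod.
Qed.

Lemma ulam_natS m :
  exists2 s, s \in [seq direction k | k <- iota 0 4] & ulam_nat m.+1 = ulam_nat m + s.
Proof.
have lt : (m < size (steps m.+1))%N by exact: size_steps.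
exists (nth 0 (steps m.+1) m); first by apply: (@mem_steps m.+1); exact: mem_nth.
rewrite /ulam_nat (take_nth 0) // -cats1 big_cat big_seq1; congr (_ + _).
rewrite {1}/steps -addn1 iotaD map_cat flatten_cat takel_cat //; exact: size_steps.
Qed.

Lemma lattice_spiral : subrel spiral_with_line lattice.
Proof.
have sub m : lattice (ulam m) (ulam (m + 1)) && lattice (ulam (m + 1)) (ulam m).
  have neg (p q : Z2) : lattice (- p) (- q) = lattice p q.
    by rewrite /lattice /= -!opprD !normrN.
  case: m => n.
    rewrite -PoszD addn1 /=; have [s hs ->] := ulam_natS n.
    exact: lattice_direction.
  have -> : Negz n + 1 = - n%:Z by rewrite NegzE -addn1 PoszD opprD subrK.
  have -> : ulam (- n%:Z) = - ulam_nat n.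
    by case: n => //=; rewrite /ulam_nat take0 big_nil oppr0.
  rewrite /= !neg andbC; have [s hs ->] := ulam_natS n.
  exact: lattice_direction.
have vert (y : int) : lattice (0, y) (0, y + 1) && lattice (0, y + 1) (0, y).
  have := @lattice_direction (0, y) (0, 1) isT.
  by have -> : ((0, y) + (0, 1) : Z2) = (0, y + 1) by congr pair; rewrite addr0.
by move=> p q /orP[]/asboolP[m [[-> ->]|[-> ->]]];
  have /andP[] := sub m; have /andP[] := vert m.
Qed.

(* Main.v *)
(* On the line [x = 0] the distance to the origin is [|y|] in every graph [e]
   between [spiral_with_line] and [lattice]. In the cone [|x| <= y] the spiral
   runs horizontally, so going up the line and then along the spiral is a
   lattice geodesic; this gives about [r / 2] vertices at distance exactly [r].
   Conversely, by induction on [r], a vertex at distance [r] in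
   [spiral_with_line] is [|t|] spiral steps away from some [(0, y)] with
   [|y| + |t| = r]: its predecessor is [ulam (m + t)] where [ulam m = (0, y)],
   and a spiral edge from there changes [t] by one, necessarily away from [0].
   Hence spheres have at most [4r + 2] vertices. *)
Require Import Defs.
From mathcomp Require Import all_boot all_order all_algebra finmap.
From mathcomp Require Import all_classical all_reals all_analysis.
From mathcomp Require Import zify lra.

Set Implicit Arguments.
Unset Strict Implicit.
Unset Printing Implicit Defensive.

Import Order.TTheory GRing.Theory Num.Theory.
Import numFieldNormedType.Exports.

Local Open Scope classical_set_scope.
Local Open Scope ring_scope.

(** * Walks, the path metric and sphere sizes *)

Section PathMetric.
Variables (V : choiceType) (e : rel V).
Hypothesis e_conn : graph_connected e.

Lemma walk0 x : walk e x x 0.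
Proof. by exists [::]. Qed.

Lemma walkS x y z n : walk e x y n -> e y z -> walk e x z n.+1.
Proof.
case=> p ep [<- <-] eyz; exists (rcons p z); first by rewrite rcons_path ep.
by rewrite last_rcons size_rcons.
Qed.

Lemma walk_cat x y z m n : walk e x y m -> walk e y z n -> walk e x z (m + n).
Proof.
case=> p ep [<- <-] [q eq [<- <-]]; exists (p ++ q); first by rewrite cat_path ep.
by rewrite last_cat size_cat.
Qed.

Lemma walkSP x z n : walk e x z n.+1 -> exists2 y, walk e x y n & e y z.
Proof.
case=> p; case/lastP: p => [_ []//|p y].
rewrite rcons_path last_rcons size_rcons => /andP[ep epy] [<- [<-]].
by exists (last x p) => //; exists p.
Qed.

Lemma walk_sym x y n : symmetric e -> walk e x y n -> walk e y x n.
Proof.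
move=> sym_e; elim: n y => [|n IH] y.
  by case=> -[|? ?] _ [] // <- _; exact: walk0.
case/walkSP=> z /IH exz ezy.
by rewrite -add1n; apply: walk_cat exz; apply: walkS (walk0 _) _; rewrite sym_e.
Qed.

Lemma gdist_le x y n : walk e x y n -> (gdist e x y <= n)%N.
Proof.
rewrite /gdist => exy; case: pselect => // h.
by case: ex_minnP => m _; apply; apply/asboolP.
Qed.

Lemma walk_gdist x y : walk e x y (gdist e x y).
Proof.
rewrite /gdist; case: pselect => [h|[]].
  by case: ex_minnP => m /asboolP.
by have [n exy] := e_conn x y; exists n; apply/asboolP.
Qed.

Lemma gdist0 x y : gdist e x y = 0%N -> y = x.
Proof. by move=> d0; have := walk_gdist x y; rewrite d0 => -[[|? ?] _ [] //]. Qed.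

Lemma gdistS x y n : gdist e x y = n.+1 -> exists2 z, e z y & gdist e x z = n.
Proof.
move=> d; have := walk_gdist x y; rewrite d => /walkSP[z exz ezy].
exists z => //; apply/eqP; rewrite eqn_leq gdist_le //=.
by rewrite -ltnS -d gdist_le //; apply: walkS ezy; exact: walk_gdist.
Qed.

Section Sphere.
Variables (x : V) (r : nat) (s : seq V).
Hypothesis ball_fin : forall n, finite_set [set y | (gdist e x y <= n)%N].

Let mem_ball n y :
  (y \in fset_set [set y | (gdist e x y <= n)%N]) = (gdist e x y <= n)%N.
Proof. by rewrite in_fset_set //; apply/idP/idP; rewrite inE. Qed.

Lemma leq_size_dbeta :
  uniq s -> (forall y, y \in s -> gdist e x y = r.+1) ->
  (size s <= dbeta e x r.+1)%N.
Proof.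
(* The subtraction in [dbeta] is truncated, so the inclusion of the smaller ball in the larger one
   comes first. *)
move=> us sr; rewrite /dbeta /beta leq_subRL; last first.
  apply: uniq_leq_size (fset_uniq _) _ => y.
  by rewrite !mem_ball => /leqW.
rewrite addnC -size_cat; apply: uniq_leq_size => [|y].
  rewrite cat_uniq us fset_uniq andbT; apply/hasPn => y; rewrite mem_ball => yr.
  by apply/negP => /sr yr1; rewrite yr1 ltnn in yr.
by rewrite mem_cat !mem_ball => /orP[/sr->//|/leqW].
Qed.

Lemma dbeta_leq_size :
  (forall y, gdist e x y = r.+1 -> y \in s) -> (dbeta e x r.+1 <= size s)%N.
Proof.
move=> sr; rewrite /dbeta /beta leq_subLR addnC -size_cat.
apply: uniq_leq_size (fset_uniq _) _ => y; rewrite mem_cat !mem_ball.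
by rewrite leq_eqVlt ltnS => /orP[/eqP/sr->//|->]; rewrite orbT.
Qed.

End Sphere.

End PathMetric.

(** Linear bounds on both sides keep [ln (dbeta e x r)] within a constant of [ln r], so their
    quotient tends to 1. Doubling [dbeta] avoids halves in the lower bound. *)
Lemma linear_sphere_dimension (V : choiceType) (e : rel V) (R : realType)
    (x : V) (C : nat) : graph_connected e ->
    (forall r, r.+2 <= 2 * dbeta e x r.+1 <= C * r.+1)%N ->
  has_dimension e x (2 : R).
Proof.
move=> e_conn bnd; split => //; apply/cvgrPdist_le => eps eps0.
(* [K] bounds the difference of the two logarithms; [C.+1] makes its second term nonnegative without
   a case on [C]. *)
pose K : R := ln 2 + ln C.+1%:R.
have ln2 : 0 <= ln (2 : R) by apply: ln_ge0; rewrite ler1n.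
have lnC : 0 <= ln (C.+1%:R : R) by apply: ln_ge0; rewrite ler1n.
near=> r.
have r1 : (1 < r)%N by near: r; exists 2%N.
have Kr : K / eps <= ln (r%:R : R).
  rewrite -ler_expR lnK ?posrE ?ltr0n; last by lia.
  by near: r; exact: nbhs_infty_ger.
have lnr0 : 0 < ln (r%:R : R) by rewrite ln_gt0 // ltr1n.
have [dr Cr] : (r <= 2 * dbeta e x r)%N /\ (dbeta e x r <= C.+1 * r)%N.
  by case: (r) r1 => // r' _; have /andP[] := bnd r'; lia.
have d0 : (0 < dbeta e x r)%N by lia.
have lo : ln (r%:R : R) <= ln 2 + ln (dbeta e x r)%:R.
  rewrite -lnM ?posrE ?ltr0n // -natrM ler_ln ?posrE ?ltr0n ?ler_nat //; lia.
have hi : ln (dbeta e x r)%:R <= ln C.+1%:R + ln (r%:R : R).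
  rewrite -lnM ?posrE ?ltr0n // -?natrM; last by lia.
  rewrite ler_ln ?posrE ?ltr0n ?ler_nat //; lia.
set a := ln (dbeta e x r)%:R in lo hi *; set b := ln r%:R in Kr lnr0 lo hi *.
have -> : 2 - (a / b + 1) = (b - a) / b.
  by rewrite mulrBl divff ?gt_eqF //; lra.
rewrite normrM normfV (gtr0_norm lnr0) ler_pdivrMr //.
move: Kr; rewrite ler_pdivrMr // mulrC => Kr.
by apply: le_trans Kr; rewrite /K ler_norml; lra.
Unshelve. all: end_near.
Qed.

(** * The Ulam spiral as the orbit of a local rule; its bijectivity *)

(* For [p != 0] the next vertex after [p] on its own arm of the spiral; at the
   origin, where both arms start, the first vertex of the positive arm. *)
Definition out (p : Z2) : Z2 :=
  if `|p.2| < `|p.1| then (p.1, p.2 + (if 0 < p.1 then 1 else -1))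
  else (p.1 + (if 0 < p.2 then -1 else 1), p.2).

(* The number of steps from the origin to [p] along the spiral. *)
Definition spiral_index (p : Z2) : int :=
  if `|p.2| < `|p.1| then
    2 * p.1 * p.1 - `|p.1| + (if 0 < p.1 then p.2 else - p.2)
  else 2 * p.2 * p.2 + `|p.2| - (if 0 < p.2 then p.1 else - p.1).

(** Closed form for the point where leg [k] starts, with [k %/ 4] counting the completed turns; see
    [sum_steps]. *)
Definition corner (k : nat) : Z2 :=
  let j := 2 * (k %/ 4)%:Z in
  match (k %% 4)%N with
  | 0 => (- j, - j)
  | 1 => (j + 1, - j)
  | 2 => (j + 1, j + 1)
  | _ => (- j - 2, j + 1)
  end.

Lemma Z2D (a b c d : int) : (a, b) + (c, d) = (a + c, b + d) :> Z2.
Proof. by []. Qed.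

Lemma mulrn_direction k i : direction k *+ i =
  match (k %% 4)%N with
  | 0 => (i%:Z, 0)
  | 1 => (0, i%:Z)
  | 2 => (- i%:Z, 0)
  | _ => (0, - i%:Z)
  end.
Proof.
elim: i => [|i IH]; first by case: (k %% 4)%N => [|[|[|]]].
by rewrite mulrS IH /direction; case: (k %% 4)%N => [|[|[|?]]];
  rewrite Z2D; congr pair; lia.
Qed.

Lemma mod4_cases k : exists j c,
  [/\ k = (j * 4 + c)%N, (k %/ 4 = j)%N, (k %% 4 = c)%N & (c < 4)%N].
Proof. by exists (k %/ 4)%N, (k %% 4)%N; rewrite -divn_eq ltn_mod. Qed.

Lemma cornerS k : corner k + direction k *+ (k./2).*2.+1 = corner k.+1.
Proof.
rewrite mulrn_direction /corner; have [j [c [-> -> -> c4]]] := mod4_cases k.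
case: c c4 => [|[|[|[|//]]]] _.
- have -> : ((j * 4 + 0).+1 %/ 4 = j)%N by lia.
  have -> : ((j * 4 + 0).+1 %% 4 = 1)%N by lia.
  by rewrite Z2D; congr pair; lia.
- have -> : ((j * 4 + 1).+1 %/ 4 = j)%N by lia.
  have -> : ((j * 4 + 1).+1 %% 4 = 2)%N by lia.
  by rewrite Z2D; congr pair; lia.
- have -> : ((j * 4 + 2).+1 %/ 4 = j)%N by lia.
  have -> : ((j * 4 + 2).+1 %% 4 = 3)%N by lia.
  by rewrite Z2D; congr pair; lia.
- have -> : ((j * 4 + 3).+1 %/ 4 = j.+1)%N by lia.
  have -> : ((j * 4 + 3).+1 %% 4 = 0)%N by lia.
  by rewrite Z2D; congr pair; lia.
Qed.

(** The case [i = 0] counts too: the strict inequalities in [out] make each corner turn into the leg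
    that starts there. *)
Lemma out_leg k i : (i < (k./2).*2.+1)%N ->
  out (corner k + direction k *+ i) = corner k + direction k *+ i.+1.
Proof.
rewrite !mulrn_direction /corner; have [j [c [-> -> -> c4]]] := mod4_cases k.
by case: c c4 => [|[|[|[|//]]]] _ ik; rewrite !Z2D /out /=;
  repeat case: ifPn => /= ?; congr pair; lia.
Qed.

Lemma iter_out_leg k i : (i <= (k./2).*2.+1)%N ->
  iter i out (corner k) = corner k + direction k *+ i.
Proof.
elim: i => [|i IH] ik; first by rewrite addr0.
by rewrite iterS IH 1?ltnW // out_leg.
Qed.

Lemma sum_nseq (d : Z2) n : \sum_(s <- nseq n d) s = d *+ n.
Proof. by rewrite big_nseq; elim: n => // n IH; rewrite iterS IH mulrS. Qed.

Lemma stepsS n : steps n.+1 = steps n ++ nseq (n./2).*2.+1 (direction n).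
Proof.
by rewrite /steps -addn1 iotaD map_cat flatten_cat /= add0n cats0.
Qed.

Lemma sum_steps n : \sum_(s <- steps n) s = corner n.
Proof.
elim: n => [|n IH]; first by rewrite big_nil.
by rewrite -cornerS stepsS big_cat IH sum_nseq.
Qed.

(** Induction on legs: the induction hypothesis at full length shows that the last leg starts at an
    iterate of [out], and [iter_out_leg] follows it from there. *)
Lemma sum_take_steps n m : (m <= size (steps n))%N ->
  \sum_(s <- take m (steps n)) s = iter m out 0.
Proof.
elim: n m => [|n IH] m; first by rewrite leqn0 => /eqP->; rewrite big_nil.
have corner_iter : iter (size (steps n)) out 0 = corner n.
  by rewrite -IH // take_size sum_steps.
rewrite stepsS size_cat size_nseq take_cat; case: ltnP => [mn _|nm mn1].
  by rewrite IH // ltnW.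
rewrite -[in RHS](subnK nm) iterD corner_iter iter_out_leg; last by lia.
by rewrite big_cat sum_steps take_nseq ?sum_nseq //; lia.
Qed.

Lemma ulam_natE m : ulam_nat m = iter m out 0.
Proof. exact/sum_take_steps/size_steps. Qed.

Lemma spiral_index_ge0 p : 0 <= spiral_index p.
Proof.
by case: p => x y; rewrite /spiral_index /=; repeat case: ifPn => /= ?; nia.
Qed.

Lemma spiral_indexN p : spiral_index (- p) = spiral_index p.
Proof.
case: p => x y; rewrite /spiral_index /= !normrN.
by repeat case: ifPn => /= ?; nia.
Qed.

(** Both halves of bijectivity rest on this: the index recovers [|m|] from [ulam m], and it
    decreases from a vertex to its predecessor. *)
Lemma spiral_index_out p : spiral_index (out p) = spiral_index p + 1.
Proof.
case: p => x y; rewrite /out /=.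
by case: ifPn => h1; case: ifPn => h2; rewrite /spiral_index /=;
  repeat case: ifPn => /= ?; nia.
Qed.

(** The point reflection swaps the arms. The origin is excluded because [out] chooses the positive
    arm there. *)
Lemma outN p : p != 0 -> out (- p) = - out p.
Proof.
case: p => x y p0; have {}p0 : (x != 0) || (y != 0).
  by apply: contraNT p0; rewrite negb_or !negbK => /andP[/eqP-> /eqP->].
by rewrite /out /= !normrN; repeat case: ifPn => /= ?; congr pair => /=; lia.
Qed.

Lemma out_pred p : p != 0 -> exists q, p = out q \/ p = - out q.
Proof.
case: p => x y p0; have {}p0 : (x != 0) || (y != 0).
  by apply: contraNT p0; rewrite negb_or !negbK => /andP[/eqP-> /eqP->].
(* The first vertex of the negative arm is the only one that needs the second alternative, since
   [out 0] is [(1, 0)]. *)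
have [->|p1] := eqVneq (x, y) (-1, 0); first by exists 0; right.
suff [q ->] : exists q, (x, y) = out q by exists q; left.
have {}p1 : (x != -1) || (y != 0).
  by apply: contraNT p1; rewrite negb_or !negbK => /andP[/eqP-> /eqP->].
(* The four regions hold the vertices entered by a step up, left, down and right, on either arm; a
   corner belongs to the leg that ends there. *)
have [h1|h1] := boolP ((- x + 1 < y) && (y <= x)).
  by exists (x, y - 1); rewrite /out /=; repeat case: ifPn => /= ?; congr pair; lia.
have [h2|h2] := boolP ((- y - 1 <= x) && (x < y)).
  by exists (x + 1, y); rewrite /out /=; repeat case: ifPn => /= ?; congr pair; lia.
have [h3|h3] := boolP ((x <= y) && (y < - x - 1)).
  by exists (x, y + 1); rewrite /out /=; repeat case: ifPn => /= ?; congr pair; lia.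
by exists (x - 1, y); rewrite /out /=; repeat case: ifPn => /= ?; congr pair; lia.
Qed.

Lemma ulamN m : ulam (- m) = - ulam m.
Proof.
case: m => [[|n]|n]; last by rewrite NegzE opprK /= opprK.
  by rewrite oppr0 /= ulam_natE oppr0.
by rewrite -NegzE.
Qed.

Lemma spiral_index_ulam m : spiral_index (ulam m) = `|m|.
Proof.
have nat_case n : spiral_index (ulam n%:Z) = n%:Z.
  rewrite /= ulam_natE; elim: n => //= n IH.
  by rewrite spiral_index_out IH -PoszD addn1.
by case: m => n; rewrite ?NegzE ?ulamN ?spiral_indexN nat_case; lia.
Qed.

(** The index leaves only [m = n] or [m = - n]. In the latter case [ulam n] is its own negative,
    hence the origin, which has index 0. *)
Lemma ulam_inj : injective ulam.
Proof.
move=> m n emn; have := congr1 spiral_index emn; rewrite !spiral_index_ulam => h.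
have [//|mn] := eqVneq m n; have mNn : m = - n by lia.
move: emn; rewrite mNn ulamN => e0.
suff /(congr1 spiral_index) : ulam n = 0.
  by rewrite spiral_index_ulam => /= n0; move: n0; rewrite /spiral_index /=; lia.
by case: (ulam n) e0 => x y [ex ey]; congr pair; lia.
Qed.

Lemma out_ulam m :
  out (ulam m) = ulam (m + 1) \/ out (ulam m) = ulam (m - 1).
Proof.
have nat_case n : out (ulam n%:Z) = ulam (n%:Z + 1).
  by rewrite -PoszD addn1 /= !ulam_natE.
case: m => n; [left; exact: nat_case | right].
have -> : Negz n - 1 = - (n.+1%:Z + 1) by lia.
rewrite NegzE !ulamN -nat_case outN //; apply/eqP => /(congr1 spiral_index).
by rewrite spiral_index_ulam /spiral_index /=; lia.
Qed.

(** Strong induction on the index along [out_pred]; a negated predecessor step is absorbed by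
    [ulamN]. *)
Lemma ulam_surj p : exists m, ulam m = p.
Proof.
have [n] := ubnP `|spiral_index p|%N; elim: n p => // n IH p ltn.
have [->|p0] := eqVneq p 0; first by exists 0; rewrite /= ulam_natE.
have [q epq] := out_pred p0.
have [m def_q] : exists m, ulam m = q.
  apply: IH; have := spiral_index_ge0 q; move: ltn.
  by case: epq => ->; rewrite ?spiral_indexN spiral_index_out; lia.
have [m' def_m'] : exists m', ulam m' = out q.
  by rewrite -def_q; case: (out_ulam m) => ->; eexists.
by case: epq => ->; [exists m' | exists (- m')]; rewrite ?ulamN def_m'.
Qed.

(** * Walks along the spiral and the line *)

Lemma spiral_with_line_sym : symmetric spiral_with_line.
Proof.
suff sub p q : spiral_with_line p q -> spiral_with_line q p.
  by move=> p q; apply/idP/idP; exact: sub.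
by case/orP=> /asboolP[m h]; apply/orP; [left|right];
  apply/asboolP; exists m; case: h; [right|left|right|left].
Qed.

Lemma ulam_edge m : spiral_with_line (ulam m) (ulam (m + 1)).
Proof. by apply/orP; left; apply/asboolP; exists m; left. Qed.

Lemma line_edge y : spiral_with_line (0, y) (0, y + 1).
Proof. by apply/orP; right; apply/asboolP; exists y; left. Qed.

Lemma out_edge p : spiral_with_line p (out p).
Proof.
have [m <-] := ulam_surj p; case: (out_ulam m) => ->; first exact: ulam_edge.
by rewrite spiral_with_line_sym -{2}[m](subrK 1) ulam_edge.
Qed.

Lemma ulam_walk m t : walk spiral_with_line (ulam m) (ulam (m + t)) `|t|.
Proof.
have nat_case m' n : walk spiral_with_line (ulam m') (ulam (m' + n%:Z)) n.
  elim: n => [|n IH]; first by rewrite addr0; exact: walk0.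
  by apply: walkS IH _; rewrite -addn1 PoszD addrA ulam_edge.
case: (lerP 0 t) => t0; first by rewrite -{1}(gez0_abs t0).
apply: (walk_sym spiral_with_line_sym).
have := nat_case (m + t) `|t|%N; congr (walk _ _ (ulam _) _); lia.
Qed.

Lemma line_walk y : walk spiral_with_line 0 (0, y) `|y|.
Proof.
have nat_case y' n : walk spiral_with_line (0, y') (0, y' + n%:Z) n.
  elim: n => [|n IH]; first by rewrite addr0; exact: walk0.
  by apply: walkS IH _; rewrite -addn1 PoszD addrA line_edge.
case: (lerP 0 y) => y0.
  by have := nat_case 0 `|y|%N; rewrite add0r gez0_abs.
apply: (walk_sym spiral_with_line_sym).
by have := nat_case y `|y|%N; rewrite ltz0_abs // subrr.
Qed.

Lemma line_spiral_walk m y t : ulam m = (0, y) ->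
  walk spiral_with_line 0 (ulam (m + t)) (`|y| + `|t|).
Proof.
by move=> def_m; apply: walk_cat (line_walk y) _; rewrite -def_m; exact: ulam_walk.
Qed.

Lemma spiral_with_line_connected : graph_connected spiral_with_line.
Proof.
move=> p q; have [m <-] := ulam_surj p; have [n <-] := ulam_surj q.
by exists `|n - m|%N; rewrite -{1}[n](subrKC m); exact: ulam_walk.
Qed.

(** * The lattice metric and its spheres *)

Definition l1 (p : Z2) : nat := `|p.1| + `|p.2|.

Lemma walk_sub (V : choiceType) (e e' : rel V) x y n :
  subrel e e' -> walk e x y n -> walk e' x y n.
Proof. by move=> ee' [p ep xyn]; exists p => //; exact: sub_path ep. Qed.

Lemma l1_walk p n : walk lattice 0 p n -> (l1 p <= n)%N.
Proof.
elim: n p => [|n IH] p; first by case=> -[|? ?] _ [] // <-.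
case/walkSP=> q /IH; rewrite /l1 /lattice; lia.
Qed.

Lemma lattice_step (p q : Z2) : p.1 = q.1 /\ `|p.2 - q.2| = 1 \/
  p.2 = q.2 /\ `|p.1 - q.1| = 1 -> lattice p q.
Proof. by rewrite /lattice => -[[-> ->]|[-> ->]]; rewrite subrr normr0. Qed.

Lemma walk_l1 p : walk lattice 0 p (l1 p).
Proof.
move: {2}(l1 p) (erefl (l1 p)) => n; elim: n p => [|n IH] [x y] n0.
  rewrite n0; have -> : (x, y) = 0; last exact: walk0.
  by move: n0; rewrite /l1 /= => n0; congr pair; lia.
rewrite n0; have [x0|x0] := eqVneq x 0.
  apply: (@walkS _ _ _ (x, y - sgz y)).
    have e : l1 (x, y - sgz y) = n by move: n0; rewrite /l1 /=; lia.
    by rewrite -[n in walk _ _ _ n]e; exact: IH.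
  by apply: lattice_step; left => /=; move: n0; rewrite /l1 /=; lia.
apply: (@walkS _ _ _ (x - sgz x, y)).
  have e : l1 (x - sgz x, y) = n by move: n0; rewrite /l1 /=; lia.
  by rewrite -[n in walk _ _ _ n]e; exact: IH.
by apply: lattice_step; right => /=; move: n0; rewrite /l1 /=; lia.
Qed.

(** The l1 sphere, two ordinates for each abscissa. The points with [t = 0] are listed twice, which
    is harmless in an upper bound. *)
Definition circle (r : nat) : seq Z2 :=
  [seq (x, t) | x <- [seq k%:Z - r%:Z | k <- iota 0 r.*2.+1],
                t <- [:: r%:Z - `|x|; `|x| - r%:Z]].

Lemma size_circle r : size (circle r) = (2 * r.*2.+1)%N.
Proof.
rewrite size_allpairs_dep -[in RHS](size_iota 0 r.*2.+1).
by elim: (iota _ _) => //= k s ->; rewrite mulnS.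
Qed.

Lemma mem_circle p : p \in circle (l1 p).
Proof.
case: p => x y; rewrite /l1 /=; apply/allpairsPdep.
exists x, y; split => //; last by rewrite !inE; lia.
apply/mapP; exists (absz (x + (`|x| + `|y|)%N%:Z)); last by lia.
by rewrite mem_iota; lia.
Qed.

(** * Graphs between [spiral_with_line] and [lattice] *)

Section BetweenSpiralAndLattice.
Variable e : rel Z2.
Hypothesis sub_spiral : subrel spiral_with_line e.
Hypothesis sub_lattice : subrel e lattice.

Lemma between_connected : graph_connected e.
Proof.
move=> p q; have [n pq] := spiral_with_line_connected p q; exists n.
exact: walk_sub pq.
Qed.

Lemma l1_gdist p : (l1 p <= gdist e 0%R p)%N.
Proof. exact/l1_walk/(walk_sub sub_lattice)/walk_gdist/between_connected. Qed.

Lemma finite_gdist_ball n : finite_set [set p | (gdist e 0%R p <= n)%N].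
Proof.
pose s := [seq p | k <- iota 0 n.+1, p <- circle k].
apply: (@sub_finite_set _ _ [set` s]); last exact: finite_seq.
move=> p /= pn; apply/allpairsPdep; exists (l1 p), p; split=> //.
  by rewrite mem_iota ltnS (leq_trans (l1_gdist p)).
exact: mem_circle.
Qed.

(** Only the left half of the cone is used: there [out] moves left, away from the line, so iterating
    it from [(0, n)] extends a geodesic. *)
Lemma gdist_top n i : (0 < n)%N -> (i <= n)%N -> gdist e 0 (- i%:Z, n%:Z) = (n + i)%N.
Proof.
move=> n0 le_in; apply/eqP; rewrite eqn_leq; apply/andP; split; last first.
  by apply: leq_trans (l1_gdist _); rewrite /l1 /=; lia.
apply/gdist_le/(walk_sub sub_spiral).
elim: i le_in => [|i IH] le_in.
  by rewrite addn0; exact: (line_walk n%:Z).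
rewrite addnS; apply: walkS (IH (ltnW le_in)) _.
suff -> : (- i.+1%:Z, n%:Z) = out (- i%:Z, n%:Z) by exact: out_edge.
by rewrite /out /=; repeat case: ifPn => /= ?; congr pair; lia.
Qed.

Lemma between_dimension (R : realType) (C : nat) :
    (forall r, exists2 s, (size s <= C * r.+1)%N &
      forall p, gdist e 0 p = r.+1 -> p \in s) ->
  has_dimension e 0 (2 : R).
Proof.
move=> sphere; apply: (@linear_sphere_dimension _ _ _ _ (2 * C)).
  exact: between_connected.
move=> r; apply/andP; split.
  (* The bound on [i] is [i <= r.+1 - i], the cone condition of [gdist_top]. *)
  pose s := [seq (- i%:Z, (r.+1 - i)%:Z) : Z2 | i <- iota 0 (r.+1)./2.+1].
  suff : (size s <= dbeta e 0%R r.+1)%N by rewrite size_map size_iota; lia.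
  apply: (leq_size_dbeta finite_gdist_ball).
    by rewrite map_inj_uniq ?iota_uniq // => i j [] /=; lia.
  move=> p /mapP[i]; rewrite mem_iota => hi ->.
  by rewrite gdist_top; lia.
have [s size_s mem_s] := sphere r; rewrite -mulnA leq_mul2l /=.
exact: leq_trans (dbeta_leq_size finite_gdist_ball mem_s) size_s.
Qed.

End BetweenSpiralAndLattice.

(** * Spheres of the spiral with the line, and the conclusion *)

Lemma spiral_sphere (a : int -> int) p r : (forall y, ulam (a y) = (0, y)) ->
  gdist spiral_with_line 0 p = r ->
  exists2 q, l1 q = r & p = ulam (a q.1 + q.2).
Proof.
move=> def_a; elim: r p => [|r IH] p d.
  exists 0 => //; rewrite addr0 def_a.
  exact: gdist0 spiral_with_line_connected _ _ d.
have [z zp /IH[[y t] l1yt def_z]] := gdistS spiral_with_line_connected d.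
case/orP: zp => /asboolP[m h].
  have [t' [tt' def_p]] : exists t', `|t' - t| = 1 /\ p = ulam (a y + t').
    case: h => -[]; rewrite def_z.
      by move=> /ulam_inj /= <- ->; exists (t + 1); rewrite addrA; split => //; lia.
    move=> -> /ulam_inj /= h; exists (t - 1); split; first by lia.
    by congr ulam; lia.
  exists (y, t') => //=.
  (* This walk gives [r.+1 <= |y| + |t'|]; as [|y| + |t| = r] and [|t'| <= |t| + 1], equality
     holds. *)
  have := gdist_le (line_spiral_walk t' (def_a y)); rewrite -def_p d.
  by move: l1yt; rewrite /l1 /=; lia.
have [y' def_p] : exists y', p = (0, y').
  by case: h => -[h1 h2]; [exists (m + 1)|exists m].
(* After a line edge the decomposition restarts with [t = 0], since a point of the line is at
   distance [|y'|] from the origin. *)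
exists (y', 0); last by rewrite addr0 def_a.
apply/eqP; rewrite eqn_leq; apply/andP; split.
  rewrite -d def_p; apply: leq_trans (l1_gdist _ lattice_spiral _) => //.
  by rewrite /l1 /=; lia.
by rewrite -d def_p /l1 /= addn0; exact/gdist_le/line_walk.
Qed.

Theorem mainTheorem1 (R : realType) :
  has_dimension spiral_with_line ((0, 0) : Z2) (2 : R) /\
  has_dimension lattice ((0, 0) : Z2) (2 : R).
Proof.
(* [circle r.+1] has [4 * r.+1 + 2] entries, at most [6 * r.+1]. *)
split; apply: (@between_dimension _ _ _ _ 6) => //; try exact: lattice_spiral.
  have [a def_a] := choice (fun y => ulam_surj (0, y)).
  move=> r; exists [seq ulam (a q.1 + q.2) | q <- circle r.+1].
    by rewrite size_map size_circle; lia.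
  move=> p /(spiral_sphere def_a)[q <- ->].
  by apply: (map_f (fun q : Z2 => ulam (a q.1 + q.2))); exact: mem_circle.
move=> r; exists (circle r.+1); first by rewrite size_circle; lia.
move=> p d; suff <- : l1 p = r.+1 by exact: mem_circle.
apply/eqP; rewrite -d eqn_leq l1_gdist //; last exact: lattice_spiral.
exact/gdist_le/walk_l1.
Qed.
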